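(* In the market model described in the context, the output $p^*$ of the ascending auction (Algorithm 1 of the context) coincides with the minimum equilibrium price vector; that is, $p^*$ is an equilibrium price vector and $p^*\le p$ componentwise for every equilibrium price vector $p$.
   Context: **Market model.** $M=\{1,\dots,m\}$ is the set of goods, $N=\{1,\dots,n\}$ with $n\ge 2$ the set of buyers, $s\in\mathbb Z_+^M$ the supply vector, and $[\mathbf 0,s]_{\mathbb Z}=\{x\in\mathbb Z_+^M : x\le s\}$ (vector inequalities are componentwise). For $x\in\mathbb R^M$ and $X\subseteq M$ put $x(X)=\sum_{j\in X}x_j$; $\chi_X\in\{0,1\}^M$ is the characteristic vector of $X$, $\chi_j=\chi_{\{j\}}$, $\chi_0=\mathbf 0$; $\operatorname{supp}_+(x)=\{j:x_j>0\}$, $\operatorname{supp}_-(x)=\{j:x_j<0\}$. Each buyer $i$ has a valuation $v_i:[\mathbf 0,s]_{\mathbb Z}\to\mathbb R_+$ with $v_i(\mathbf 0)=0$, monotone ($x\le y\Rightarrow v_i(x)\le v_i(y)$), and $\mathrm M^\natural$-concave: for all $x,x'\in[\mathbf 0,s]_{\mathbb Z}$ and $j\in\operatorname{supp}_+(x-x')$ there is $k\in\operatorname{supp}_-(x-x')\cup\{0\}$ with $v_i(x)+v_i(x')\le v_i(x-\chi_j+\chi_k)+v_i(x'+\chi_j-\chi_k)$ (with $v_i=-\infty$ outside $[\mathbf 0,s]_{\mathbb Z}$). For each $(i,j)\in N\times M$ there is a payment function $q_{ij}:\mathbb R_+\to\mathbb R_+$ that is continuous, piecewise-linear (specified by finitely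 many breakpoints and slopes), strictly increasing, with $q_{ij}(0)=0$, and such that $q_{ij}(\kappa)=v_i(\chi_j)$ for some $\kappa\in\mathbb R_+$; $q'_{ij}$ denotes its right derivative. For a price vector $p\in\mathbb R_+^M$, $u_i(x;p)=v_i(x)-\sum_{j\in M}q_{ij}(p_j)x_j$, $D_i(p)=\arg\max_{x\in[\mathbf 0,s]_{\mathbb Z}}u_i(x;p)$, and $\check D_i(p)$ is the set of (componentwise) minimal elements of $D_i(p)$. **Equilibrium.** $p\in\mathbb R_+^M$ is an equilibrium price vector if there exist $x_i\in D_i(p)$ $(i\in N)$ with $\sum_{i\in N}x_i=s$. (It is known that in this model equilibrium price vectors exist and form a lattice with a unique minimum element.) **Over-demand.** $\mu_i(X;p)=\min\{x(X):x\in D_i(p)\}$ and $\mathcal O(X;p)=\sum_{i\in N}\mu_i(X;p)-s(X)$ for $X\subseteq M$. The function $\mathcal O(\cdot;p)$ is supermodular, so it has a unique inclusion-minimal maximizer. **Local Stability Condition (LSC).** A direction $d\in\mathbb R_+^M$ satisfies (LSC) at $p$ if there is $\delta>0$ such that for every $\varepsilon\in[0,\delta)$ the set $\operatorname{supp}_+(d)$ is the unique minimal maximizer of $\mathcal O(\cdot;p+\varepsilon d)$. **Lexicographic dual problem $(D_2)$ at $p$.** Let $\check\rho_i(X;p)=\max\{x(X):x\in\check D_i(p)\}$ and $P(\check\rho_i)=\{x\in\mathbb Z_+^M: x(S)\le\check\rho_i(S;p)\ \forall S\subseteq M\}$. Let $\gamma$ be a symbolic ''sufficiently small'' positive constant: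 let $\mathbb R_\gamma=\{a+\gamma b: a,b\in\mathbb R\}$ (identified with pairs $(a,b)$), with addition componentwise in $(a,b)$ and with the lexicographic order ($a_1+\gamma b_1>a_2+\gamma b_2$ iff $a_1>a_2$, or $a_1=a_2$ and $b_1>b_2$); vectors over $\mathbb R_\gamma$ are compared componentwise. Put $w_{ij}=1-\gamma\log q'_{ij}(p_j)$. Problem $(D_2)$ is to minimize, over $z\in\mathbb R_\gamma^M$ with $z\ge\mathbf 0$, $\mathcal L(z)=\sum_{i\in N}\max_{x_i\in P(\check\rho_i)}\sum_{j\in M}(w_{ij}-z_j)x_{ij}+\sum_{j\in M}s_jz_j$. It has a unique minimal optimal solution $z^*$, and $z^*=\chi_{X^*}+\gamma t$ with $t\in\mathbb R^M$, where $X^*$ is the unique minimal maximizer of $\mathcal O(\cdot;p)$. **Direction procedure (Algorithm 2).** Given $p$, compute the unique minimal optimal solution $z^*=\chi_{X^*}+\gamma t$ of problem $(D_2)$ at $p$ (with $t\in\mathbb R^M$ and $X^*$ the unique minimal maximizer of $\mathcal O(\cdot;p)$) and return $(X^*,d^* )$ with $d^*_j=\exp(t_j)$ for $j\in X^*$ and $d^*_j=0$ for $j\notin X^*$. (The returned $d^*$ satisfies (LSC) at $p$.) **Ascending auction (Algorithm 1).** Start with $p=\mathbf 0$. Iterate: compute $(X^*,d^* )$ at the current $p$ by the direction procedure. If $X^*=\emptyset$, output $p^*:=p$ and terminate. Otherwise increase the price along $d^*$ until, at the price $p+c\,d^*$ ($c>0$), for the first time one of the following occurs: (a) $X^*$ is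 no longer the minimal maximizer of $\mathcal O(\cdot;p+c\,d^* )$; (b) $X^*$ is still the minimal maximizer of $\mathcal O(\cdot;p+c\,d^* )$ but $d^*$ violates (LSC) at $p+c\,d^*$. With $\bar c$ this first value of $c$, replace $p$ by $p+\bar c\,d^*$ and start the next iteration. (The auction terminates after finitely many iterations.) *)

(* Defs.v *)
From HB Require Import structures.
From mathcomp Require Import all_boot all_order all_algebra.
From mathcomp Require Import all_classical all_reals all_analysis.

Set Implicit Arguments.
Unset Strict Implicit.
Unset Printing Implicit Defensive.

Import Order.TTheory GRing.Theory Num.Theory.
Import numFieldNormedType.Exports.

Local Open Scope classical_set_scope.
Local Open Scope ring_scope.

Definition minimal_elts {T : Type} (le : T -> T -> Prop) (A : set T) : set T :=
  [set x | A x /\ forall y, A y -> le y x -> y = x].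

Definition unique_minimal {T : Type} (le : T -> T -> Prop) (A : set T) (x : T)
  : Prop := minimal_elts le A = [set x].

(* The default [x0] is returned only if [A] has no maximum (resp. minimum). *)
Definition set_max {d : Order.disp_t} {T : porderType d} (x0 : T) (A : set T)
  : T := xget x0 [set a | A a /\ forall b, A b -> (b <= a)%O].

Definition set_min {d : Order.disp_t} {T : porderType d} (x0 : T) (A : set T)
  : T := xget x0 [set a | A a /\ forall b, A b -> (a <= b)%O].

(* [(a, b)] stands for a + gamma b: lexicographic order, componentwise sum.   *)
Definition rgamma (R : realType) : Type := (R *l R)%type.

HB.instance Definition _ (R : realType) :=
  Order.Total.copy (rgamma R) (R *l R)%type.
HB.instance Definition _ (R : realType) :=
  GRing.Zmodule.copy (rgamma R) (R * R)%type.

Definition bundle (m : nat) : Type := {ffun 'I_m -> nat}.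

Section Bundles.
Context {m : nat}.
Implicit Types (x y s : bundle m) (X : {set 'I_m}).

Definition bundle0 : bundle m := [ffun=> 0%N].

Definition bundle_le x y : Prop := forall j, (x j <= y j)%N.

Definition box s : set (bundle m) := [set x | bundle_le x s].

Definition total x X : nat := (\sum_(j in X) x j)%N.

(* [chi None] is the zero vector written chi_0 in exchange properties.        *)
Definition chi (k : option 'I_m) : bundle m := [ffun j => nat_of_bool (k == Some j)].

Definition bundle_add x y : bundle m := [ffun j => (x j + y j)%N].
Definition bundle_sub x y : bundle m := [ffun j => (x j - y j)%N].

Definition bundle_sum (n : nat) (x : 'I_n -> bundle m) : bundle m :=
  [ffun j => (\sum_(i < n) x i j)%N].

(* Since [x' j < x j], and [x k < x' k] when [k] is a good, no subtraction    *)
(* truncates and both exchanged vectors lie in [box s]: extending [v] by      *)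
(* -oo outside [box s] would give the same condition.                         *)
Definition Mnat_concave {R : realType} s (v : bundle m -> R) : Prop :=
  forall x x', box s x -> box s x' ->
  forall j, (x' j < x j)%N ->
  exists k : option 'I_m,
    (if k is Some l then (x l < x' l)%N : Prop else True) /\
    v x + v x' <=
      v (bundle_add (bundle_sub x (chi (Some j))) (chi k)) +
      v (bundle_sub (bundle_add x' (chi (Some j))) (chi k)).

End Bundles.

(* The breakpoints are 0 and the elements of [bs]; the l-th slope is that of  *)
(* the piece starting at the l-th breakpoint, the last piece being unbounded. *)
Definition piecewise_linear {R : realType} (q : R -> R) : Prop :=
  exists bs slopes : seq R,
    [/\ sorted <%R (0 :: bs),
        size slopes = (size bs).+1 &
        forall l : nat, (l <= size bs)%N ->
        forall t : R, (0 :: bs)`_l <= t ->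
          ((l < size bs)%N -> t <= bs`_l) ->
          q t = q (0 :: bs)`_l + slopes`_l * (t - (0 :: bs)`_l)].

Definition right_derivative {R : realType} (q : R -> R) (t : R) : R :=
  lim ((fun h : R => h^-1 * (q (t + h) - q t)) @ 0^'+).

(* [valuation i] and [payment i j] are total functions, constrained only on   *)
(* [box supply] and on the nonnegative reals; accordingly [payment_reach] is  *)
(* required only where v_i(chi_j) is defined.                                 *)
Record market (R : realType) (m n : nat) := Market {
  supply : bundle m;
  valuation : 'I_n -> bundle m -> R;
  payment : 'I_n -> 'I_m -> R -> R;
  valuation_ge0 : forall i x, box supply x -> 0 <= valuation i x;
  valuation0 : forall i, valuation i bundle0 = 0;
  valuation_monotone : forall i x y, box supply x -> box supply y ->
    bundle_le x y -> valuation i x <= valuation i y;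
  valuation_concave : forall i, Mnat_concave supply (valuation i);
  payment_ge0 : forall i j t, 0 <= t -> 0 <= payment i j t;
  payment_continuous : forall i j,
    {within [set t : R | 0 <= t], continuous (payment i j)};
  payment_piecewise_linear : forall i j, piecewise_linear (payment i j);
  payment_increasing : forall i j t t', 0 <= t -> t < t' ->
    payment i j t < payment i j t';
  payment0 : forall i j, payment i j 0 = 0;
  payment_reach : forall i j, box supply (chi (Some j)) ->
    exists2 kappa : R, 0 <= kappa & payment i j kappa = valuation i (chi (Some j))
}.

Section Auction.
Context {R : realType} {m n : nat}.
Variable M : market R m n.

Local Notation price := ('I_m -> R).
Local Notation s := (supply M).

Implicit Types (p d : price) (X : {set 'I_m}) (i : 'I_n) (x : bundle m).

Definition utility i x p : R :=
  valuation M i x - \sum_(j < m) payment M i j (p j) * (x j)%:R.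

Definition demand i p : set (bundle m) :=
  [set x | box s x /\ forall y, box s y -> utility i y p <= utility i x p].

Definition minimal_demand i p : set (bundle m) :=
  minimal_elts bundle_le (demand i p).

Definition equilibrium p : Prop :=
  (forall j, 0 <= p j) /\
  exists x : 'I_n -> bundle m,
    (forall i, demand i p (x i)) /\ bundle_sum x = s.

Definition mu i X p : nat := set_min 0%N [set total x X | x in demand i p].

Definition overdemand p X : int :=
  \sum_(i < n) (mu i X p)%:Z - (total s X)%:Z.

Definition maximizers p : set {set 'I_m} :=
  [set X | forall Y, overdemand p Y <= overdemand p X].

Definition minimal_maximizer p X : Prop :=
  unique_minimal (fun Y Z : {set 'I_m} => Y \subset Z) (maximizers p) X.

Definition supp_pos d : {set 'I_m} := [set j | 0 < d j]%SET.

Definition move p (c : R) d : price := fun j => p j + c * d j.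

Definition LSC p d : Prop :=
  exists2 delta : R, 0 < delta &
    forall eps : R, 0 <= eps < delta ->
      minimal_maximizer (move p eps d) (supp_pos d).

Definition rho i X p : nat :=
  set_max 0%N [set total x X | x in minimal_demand i p].

Definition rho_polytope i p : set (bundle m) :=
  [set x | forall X, (total x X <= rho i X p)%N].

Definition weight p i (j : 'I_m) : rgamma R :=
  (1, - ln (right_derivative (payment M i j) (p j))).

Definition dual_objective p (z : 'I_m -> rgamma R) : rgamma R :=
  \sum_(i < n)
    set_max (0 : rgamma R)
      [set \sum_(j < m) (weight p i j - z j) *+ x j | x in rho_polytope i p]
  + \sum_(j < m) z j *+ s j.

Definition dual_optimal p : set ('I_m -> rgamma R) :=
  [set z : 'I_m -> rgamma R | (forall j, ((0 : rgamma R) <= z j)%O) /\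
     forall z' : 'I_m -> rgamma R, (forall j, ((0 : rgamma R) <= z' j)%O) ->
       (dual_objective p z <= dual_objective p z')%O].

Definition dual_solution p (z : 'I_m -> rgamma R) : Prop :=
  unique_minimal (fun y y' : 'I_m -> rgamma R => forall j, (y j <= y' j)%O)
    (dual_optimal p) z.

Definition direction p X d : Prop :=
  minimal_maximizer p X /\
  exists t : 'I_m -> R,
    dual_solution p (fun j => ((j \in X)%:R, t j)) /\
    d = (fun j => if j \in X then expR (t j) else 0).

Definition price_event p X d (c : R) : Prop :=
  ~ minimal_maximizer (move p c d) X \/
  (minimal_maximizer (move p c d) X /\ ~ LSC (move p c d) d).

Definition first_event p X d (c : R) : Prop :=
  [/\ 0 < c, price_event p X d c &
      forall c' : R, 0 < c' < c -> ~ price_event p X d c'].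

Inductive auction_reaches : price -> Prop :=
| auction_start : auction_reaches (fun=> 0)
| auction_step p X d c :
    auction_reaches p -> direction p X d -> X <> finset.set0 ->
    first_event p X d c -> auction_reaches (move p c d).

Definition auction_output p : Prop :=
  auction_reaches p /\ exists d, direction p finset.set0 d.

End Auction.

(* Main.v *)
Require Import Defs.
From mathcomp Require Import all_boot all_order all_algebra.
From mathcomp Require Import all_classical all_reals all_analysis.
From mathcomp Require Import zify ring lra.

Import Order.TTheory GRing.Theory Num.Theory.
Import numFieldNormedType.Exports.
Local Open Scope classical_set_scope.
Local Open Scope ring_scope.

Set Implicit Arguments.
Unset Strict Implicit.
Unset Printing Implicit Defensive.

(* Two properties are preserved along the auction: [p] lies below every
   equilibrium, and some selection of demanded bundles sums to at least the
   supply [s].  The first holds because, as long as [X] is the minimal maximizer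
   of over-demand, removing from [X] the goods whose price already equals an
   equilibrium price would not lower the over-demand (gross substitutes), so no
   such good exists.  For the second, while [X] maximizes over-demand the buyers
   demand at least [s(Z)] from each [Z] inside [X], goods outside [X] are not
   demanded less when only prices in [X] rise, and the property passes to the
   price at the event by continuity of the payments.  When the empty set
   maximizes over-demand, some selection also sums to at most [s]; the aggregate
   demand is M-natural-convex and hence contains [s] itself. *)

Lemma exists_minimizer {T : Type} (P : T -> Prop) (f : T -> nat) :
  (exists x, P x) -> exists2 x, P x & forall y, P y -> (f x <= f y)%N.
Proof.
move=> [x0 Px0]; move: {2}(f x0).+1 (ltnSn (f x0)) => N.
elim: N x0 Px0 => // N IHN x Px xN.
have [[y Py yx]|noy] := pselect (exists2 y, P y & (f y < f x)%N).
  by apply: (IHN y) => //; lia.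
exists x => // y Py; rewrite leqNgt; apply/negP => yx.
by apply: noy; exists y.
Qed.

(** * M-natural exchange for sets of integer vectors *)

Section ExchangeSets.
Context {T : finType}.
Implicit Types (x y z s : {ffun T -> int}) (A : set {ffun T -> int}).
Implicit Types (k : option T) (X : {set T}).

Definition unitv k : {ffun T -> int} := [ffun j => (k == Some j : nat)%:Z].

(** [None] stands for an exchange that receives no good, which is always admissible. *)
Definition below x y k : bool := if k is Some l then x l < y l else true.

Definition dist x y : nat := (\sum_j `|(x j - y j)%R|)%N.

Definition tot x X : int := \sum_(j in X) x j.

(** Only [x] moves here; the exchange that moves [y] is the same property of [oppset A]. Minkowski
    sums can thus be handled one side at a time. *)
Definition exchange_down A : Prop := forall x y, A x -> A y ->
  forall j, y j < x j ->
  exists2 k, below x y k & A (x - unitv (Some j) + unitv k).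

Definition oppset A : set {ffun T -> int} := [set x | A (- x)].

Lemma unitv_None : unitv None = 0.
Proof. by apply/ffunP => j; rewrite !ffunE. Qed.

Lemma exchangeE x j k t : (x - unitv (Some j) + unitv k) t =
  x t - (j == t : nat)%:Z + (k == Some t : nat)%:Z.
Proof. by rewrite !ffunE. Qed.

Lemma tot_exchange x j k X : tot (x - unitv (Some j) + unitv k) X =
  tot x X - (j \in X : nat)%:Z +
  (if k is Some l then (l \in X : nat) else 0)%:Z.
Proof.
have tot1 l : \sum_(t in X) (l == t : nat)%:Z = (l \in X : nat)%:Z.
  have [lX|lX] := boolP (l \in X).
    rewrite (bigD1 l) //= eqxx big1 ?addr0 // => t /andP[_ tl].
    by rewrite eq_sym (negbTE tl).
  rewrite big1 // => t tX; case: eqP => // lt.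
  by rewrite lt tX in lX.
rewrite /tot; under eq_bigr do rewrite exchangeE.
rewrite big_split sumrB /= tot1; congr (_ + _).
by case: k => [l|]; [exact: tot1|rewrite big1].
Qed.

Lemma dist_exchange x y j k : y j < x j -> below x y k ->
  (dist (x - unitv (Some j) + unitv k)%R y < dist x y)%N.
Proof.
move=> yx kxy; rewrite /dist (bigD1 j) //= [ltnRHS](bigD1 j) //=.
have kj : (k == Some j) = false.
  case: k kxy => //= l lxy; apply/eqP => -[lj].
  by move: lxy yx; rewrite lj; lia.
rewrite -addSn leq_add //.
  by rewrite exchangeE eqxx kj; lia.
apply: leq_sum => t tj; rewrite exchangeE eq_sym (negbTE tj).
by case: eqP => kt; [move: kxy; rewrite kt /=; lia | lia].
Qed.

Lemma dist_exchange_r x y j k : y j < x j -> below x y k ->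
  (dist x (y + unitv (Some j) - unitv k)%R < dist x y)%N.
Proof.
have distN z : dist x z = dist (- z) (- x).
  by apply: eq_bigr => t _; rewrite !ffunE opprK addrC.
move=> yx kxy; rewrite !distN opprB opprD addrC dist_exchange //.
  by rewrite !ffunE ltrN2.
by case: k kxy => //= l; rewrite !ffunE ltrN2.
Qed.

(* A family is moved towards [g] one exchange at a time; whenever the exchange
   returns a good that is not short in the sum, some member has a surplus of
   that good, which is exchanged next. *)
Lemma minkowski_exchange {I : finType} (D : I -> set {ffun T -> int}) :
  (forall i, exchange_down (D i)) ->
  exchange_down [set \sum_i f i | f in [set f | forall i, D i (f i)]].
Proof.
move=> exD x y [f0 Df0 f0E] [g Dg gE] j0 yx.
suff walk N : forall f j, (forall i, D i (f i)) -> y j <= x j ->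
    \sum_i f i = x - unitv (Some j0) + unitv (Some j) ->
    (\sum_i dist (f i) (g i) < N)%N ->
    exists2 k, below x y k &
      [set \sum_i f i | f in [set f | forall i, D i (f i)]]
        (x - unitv (Some j0) + unitv k).
  by apply: (walk _ f0 j0 Df0 (ltW yx) _ (ltnSn _)); rewrite subrK.
elim: N => // N IHN f j Df yxj fE fN.
(* At [j] the sum exceeds [y j]: it is [x j + 1], or [x j > y j] when [j] is [j0]. *)
have [i gf] : exists i, g i j < f i j.
  apply/not_existsP => gf; suff : (\sum_i f i) j <= y j.
    by rewrite fE exchangeE eqxx; case: eqP => [<-|]; lia.
  rewrite -gE !sum_ffunE; apply: ler_sum => i _; rewrite leNgt; exact/negP/gf.
have [k kfg Dk] := exD i _ _ (Df i) (Dg i) _ gf.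
pose f' i' := if i' == i then f i - unitv (Some j) + unitv k else f i'.
have Df' i' : D i' (f' i') by rewrite /f'; case: eqP => [->|].
have f'E : \sum_i f' i = x - unitv (Some j0) + unitv k.
  rewrite (bigD1 i) //= {1}/f' eqxx.
  rewrite (eq_bigr f); last by move=> i' /negbTE; rewrite /f' => ->.
  have -> : x - unitv (Some j0) = \sum_i f i - unitv (Some j).
    by rewrite fE addrK.
  rewrite [in RHS](bigD1 i) //= -!addrA; congr (_ + _).
  by rewrite addrA [RHS]addrC.
have [kxy|kxy] := boolP (below x y k).
  by exists k => //; exists f'.
case: k => [l|] // in kfg Dk f' Df' f'E kxy *.
rewrite /= -leNgt in kxy.
apply: (IHN f' l) => //; rewrite ltnS in fN; apply: leq_trans fN.
rewrite (bigD1 i) //= [ltnRHS](bigD1 i) //= -addSn leq_add //.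
  by rewrite /f' eqxx; exact: dist_exchange.
by apply: leq_sum => i' /negbTE; rewrite /f' => ->.
Qed.

Lemma oppset_minkowski {I : finType} (D : I -> set {ffun T -> int}) :
  oppset [set \sum_i f i | f in [set f | forall i, D i (f i)]] =
  [set \sum_i f i | f in [set f | forall i, oppset (D i) (f i)]].
Proof.
apply/seteqP; split => x /= [f Df fE].
  exists (fun i => - f i) => [i|]; first by rewrite /oppset /= opprK.
  by rewrite sumrN fE opprK.
by exists (fun i => - f i) => //; rewrite sumrN fE.
Qed.

(** The premise on exchanges says that a good of [X] is only given up for a good of [X]. A
    counterexample [z] closest to [y] is at most [y] on [X], so no exchange of [y] towards [z] can
    receive a good of [X]. *)
Lemma exchange_local_min A y X : exchange_down A -> A y ->
  (forall j k, j \in X -> A (y - unitv (Some j) + unitv k) ->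
    exists2 l, l \in X & k = Some l) ->
  forall z, A z -> tot y X <= tot z X.
Proof.
move=> exA Ay cl z0 Az0; rewrite leNgt; apply/negP => z0y.
have [z [Az zy] minz] := @exists_minimizer _
  (fun z => A z /\ tot z X < tot y X) (dist^~ y) (ex_intro _ z0 (conj Az0 z0y)).
have zley j : j \in X -> z j <= y j.
  move=> jX; rewrite leNgt; apply/negP => yzj.
  have [k kzy Ak] := exA _ _ Az Ay _ yzj.
  suff /minz : A (z - unitv (Some j) + unitv k) /\
      tot (z - unitv (Some j) + unitv k) X < tot y X.
    by rewrite /= leqNgt dist_exchange.
  split=> //; rewrite tot_exchange jX; apply: le_lt_trans zy.
  by case: k {kzy Ak} => [l|]; try case: (l \in X); lia.
have [j jX zyj] : exists2 j, j \in X & z j < y j.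
  apply/not_exists2P => nj; move: zy; apply/negP; rewrite -leNgt.
  by apply: ler_sum => j jX; case: (nj j) => // /negP; rewrite -leNgt.
have [k kyz Ak] := exA _ _ Ay Az _ zyj.
have [l lX kl] := cl _ _ jX Ak.
by move: kyz; rewrite kl /=; have := zley _ lX; lia.
Qed.

(** Exchangeability at [y] is transitive, up to losing [i] without return. *)
Lemma exchange_trans A y i j k : exchange_down A -> exchange_down (oppset A) ->
  A y -> A (y - unitv (Some i) + unitv (Some j)) ->
  A (y - unitv (Some j) + unitv k) ->
  A (y - unitv (Some i)) \/ A (y - unitv (Some i) + unitv k).
Proof.
set u := _ + unitv (Some j); set w := _ + unitv k => dn up Ay Au Aw.
have [ij|ij] := eqVneq i j; first by right; rewrite ij.
have [kj|kj] := eqVneq k (Some j); first by right; rewrite kj.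
have [ki|ki] := eqVneq k (Some i); first by right; rewrite ki subrK.
have uw : u i < w i.
  rewrite /u /w !exchangeE eqxx (negbTE ki) (inj_eq Some_inj).
  by rewrite [j == i]eq_sym (negbTE ij); lia.
(* [w] is below [u] at [j] only, so the good received is [j] or none. *)
have [[l|] lwu Al] := dn _ _ Aw Au _ uw.
  have lj : l = j.
    apply/eqP; move: lwu; rewrite /u /w /= !exchangeE.
    rewrite (inj_eq Some_inj) [j == l]eq_sym.
    by do !case: eqP => //; lia.
  right; move: Al; rewrite lj /w; congr A.
  by apply/ffunP => t; rewrite /w !ffunE; ring.
set a := _ + _ in Al.
(* Nothing was received, so [j] is given back: [a] is above [u] at most at [k], hence only [k] can
   be given up for it. *)
have ua : (- u) j < (- a) j.
  rewrite /a /u /w !ffunE.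
  by rewrite !(inj_eq Some_inj) (negbTE ij) eqxx /=; lia.
have [l lau] := up (- a) (- u) ltac:(by rewrite /oppset /= opprK)
  ltac:(by rewrite /oppset /= opprK) _ ua.
rewrite /oppset /= => Ab.
case: l => [l|] in lau Ab *.
  left; have lk : k = Some l.
    apply/eqP; move: lau; rewrite /a /u /w /= !ffunE !(inj_eq Some_inj).
    by do !case: eqP => //; lia.
  move: Ab; rewrite /a /w lk; congr A.
  by apply/ffunP => t; rewrite /a /u /w !ffunE /=; ring.
right; move: Ab; congr A.
by apply/ffunP => t; rewrite /a /u /w !ffunE /=; ring.
Qed.

(* Rado-type feasibility: starting from a member of least total excess over [s],
   the goods that an excess good can be exchanged for form a violating set. *)
Lemma exchange_le A s : exchange_down A -> exchange_down (oppset A) ->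
  (forall X, exists2 x, A x & tot x X <= tot s X) ->
  exists2 x, A x & forall j, x j <= s j.
Proof.
move=> dn up As.
pose excess x := (\sum_j `|(Num.max 0 (x j - s j))%R|)%N.
have [y Ay miny] : exists2 y, A y & forall x, A x -> (excess y <= excess x)%N.
  by apply: exists_minimizer; have [x Ax _] := As finset.set0; exists x.
exists y => // i; rewrite leNgt; apply/negP => si.
have excess_move k : (if k is Some l then y l < s l else true) ->
    ~ A (y - unitv (Some i) + unitv k).
  move=> kys /miny; apply/negP; rewrite -ltnNge.
  rewrite /excess (bigD1 i) //= [ltnRHS](bigD1 i) //= -addSn leq_add //.
    rewrite exchangeE eqxx; case: eqP => [kE|_] /=; last by lia.
    by move: kys; rewrite kE; lia.
  apply: leq_sum => t ti; rewrite exchangeE eq_sym (negbTE ti).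
  by case: eqP => [kE|_]; [move: kys; rewrite kE /=; lia | lia].
pose X := [set j | `[< A (y - unitv (Some i) + unitv (Some j)) >]]%SET.
have XP j : reflect (A (y - unitv (Some i) + unitv (Some j))) (j \in X).
  by rewrite inE; exact: asboolP.
have [x Ax xs] := As X.
(* By transitivity [X] is closed under exchange, because losing [i] outright would lower the
   excess. *)
have yx : tot y X <= tot x X.
  apply: (exchange_local_min dn Ay) => // j k /XP Aj Ak.
  have [Ai|Aik] := exchange_trans dn up Ay Aj Ak.
    by case: (excess_move None) => //; rewrite unitv_None addr0.
  case: k {Ak} => [l|] in Aik *; first by exists l => //; apply/XP.
  by case: (excess_move None).
have iX : i \in X by apply/XP; rewrite subrK.
(* A good of [X] below [s] would allow an exchange lowering the excess, so [y] is at least [s] on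
   [X], strictly at [i]. *)
suff : tot s X < tot y X by move: (le_trans yx xs); lia.
rewrite /tot (bigD1 i) //= [ltRHS](bigD1 i) //= ltr_leD //.
apply: ler_sum => j /andP[/XP Aj _]; rewrite leNgt; apply/negP => ysj.
exact: (excess_move (Some j)).
Qed.

(** Reflection of [exchange_le] through the origin. *)
Lemma exchange_ge A s : exchange_down A -> exchange_down (oppset A) ->
  (forall X, exists2 x, A x & tot s X <= tot x X) ->
  exists2 x, A x & forall j, s j <= x j.
Proof.
move=> dn up As.
have totN x X : tot (- x) X = - tot x X.
  by rewrite /tot -sumrN; apply: eq_bigr => j _; rewrite ffunE.
have oppsetK : oppset (oppset A) = A.
  by apply/seteqP; split => x; rewrite /oppset /= opprK.
have [||x Ax xs] := @exchange_le (oppset A) (- s) up; first by rewrite oppsetK.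
  move=> X; have [x Ax sx] := As X; exists (- x); rewrite ?totN ?lerN2 //.
  by rewrite /oppset /= opprK.
by exists (- x) => // j; have := xs j; rewrite !ffunE lerNr.
Qed.

(** A member [z] above [s] and closest to [y] must be [s]: as [y] is at most [z], an exchange
    towards [y] only removes a unit, and removing it where [s j < z j] stays above [s]. *)
Lemma exchange_between A s x y : exchange_down A -> A x -> A y ->
  (forall j, y j <= s j) -> (forall j, s j <= x j) -> A s.
Proof.
move=> dn Ax0 Ay ys sx0.
have [z [Az sz] minz] := @exists_minimizer _
  (fun z => A z /\ forall j, s j <= z j) (dist^~ y)
  (ex_intro _ x (conj Ax0 sx0)).
suff -> : s = z by [].
apply/ffunP => j; apply/eqP; rewrite eq_le sz leNgt /=; apply/negP => szj.
have yz : y j < z j by apply: le_lt_trans szj.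
have [[l|] /= lzy Al] := dn _ _ Az Ay _ yz.
  by move: (le_trans (ys l) (sz l)); lia.
suff /minz : A (z - unitv (Some j) + unitv None) /\
    forall t, s t <= (z - unitv (Some j) + unitv None) t.
  by rewrite /= leqNgt dist_exchange.
by split=> // t; rewrite exchangeE addr0; have := sz t; case: eqP => [<-|]; lia.
Qed.

End ExchangeSets.

(** * Auxiliary facts on sums, finite boxes and filters *)

Lemma totID {T : finType} (x : {ffun T -> int}) (X Y : {set T}) :
  tot x X = tot x (X :&: Y) + tot x (X :\: Y).
Proof. by rewrite /tot (big_setID Y). Qed.

Lemma tot_sum {T I : finType} (f : I -> {ffun T -> int}) (X : {set T}) :
  tot (\sum_i f i) X = \sum_i tot (f i) X.
Proof.
by rewrite exchange_big /=; apply: eq_bigr => j _; rewrite sum_ffunE.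
Qed.

Lemma le_tot {T : finType} (x y : {ffun T -> int}) (X : {set T}) :
  (forall j, j \in X -> x j <= y j) -> tot x X <= tot y X.
Proof. exact: ler_sum. Qed.

Lemma PoszS {I : Type} (r : seq I) (P : pred I) (F : I -> nat) :
  (\sum_(i <- r | P i) F i)%N%:Z = \sum_(i <- r | P i) (F i)%:Z.
Proof. exact: (big_morph Posz PoszD). Qed.

Lemma seq_argmax {R : realType} {T : eqType} (f : T -> R) (l : seq T) x0 :
  x0 \in l -> exists2 x, x \in l & forall y, y \in l -> f y <= f x.
Proof.
elim: l x0 => // a l IHl x0 _.
case: l => [|b l] in IHl *.
  by exists a; rewrite ?mem_head // => y; rewrite inE => /eqP ->.
have [x xl xmax] := IHl b (mem_head _ _).
have [ax|xa] := leP (f a) (f x).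
  exists x; first by rewrite inE xl orbT.
  by move=> y; rewrite inE => /orP[/eqP -> //|]; exact: xmax.
exists a; first exact: mem_head.
move=> y; rewrite inE => /orP[/eqP -> //|yl].
exact: le_trans (xmax _ yl) (ltW xa).
Qed.

Lemma finite_box {m : nat} (s : bundle m) :
  exists l : seq (bundle m), forall x, box s x <-> x \in l.
Proof.
pose K := \max_j s j.
pose dec (g : {ffun 'I_m -> 'I_K.+1}) : bundle m := [ffun j => val (g j)].
exists [seq x : bundle m <- [seq dec g | g <- enum {: {ffun 'I_m -> 'I_K.+1}}]
  | [forall j, (x j <= s j)%N]] => x.
rewrite mem_filter; split=> [xs|/andP[/forallP xs _] //].
apply/andP; split; first exact/forallP.
have xK j : (x j < K.+1)%N.
  by rewrite ltnS (leq_trans (xs j)) //; exact: (@leq_bigmax _ s j).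
apply/mapP; exists [ffun j => Ordinal (xK j)]; first by rewrite mem_enum.
by apply/ffunP => j; rewrite !ffunE.
Qed.

Lemma near_all {T : eqType} {S : Type} (F : set_system S) (l : seq T)
    (P : T -> S -> Prop) : Filter F ->
  (forall x, x \in l -> \forall c \near F, P x c) ->
  \forall c \near F, forall x, x \in l -> P x c.
Proof.
move=> FF; elim: l => [|a l IHl] Pl.
  by apply: filterE => c x; rewrite in_nil.
have /IHl Ql x : x \in l -> \forall c \near F, P x c.
  by move=> xl; apply: Pl; rewrite inE xl orbT.
apply: filterS2 (Pl a (mem_head _ _)) Ql => c Pa Pl' x.
by rewrite inE => /orP[/eqP -> //|]; exact: Pl'.
Qed.

(** * Demand sets as exchange sets *)

Section Market.
Context {R : realType} {m n : nat}.
Variable M : market R m n.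
Local Notation price := ('I_m -> R).
Local Notation vec := {ffun 'I_m -> int}.
Implicit Types (c : R) (p q d : price) (X Y Z T : {set 'I_m}).
Implicit Types (i : 'I_n) (j : 'I_m).

Definition intv (x : bundle m) : vec := [ffun j => (x j)%:Z].

Definition int_demand p i : set vec := [set intv x | x in demand M i p].

Definition aggregate_demand p : set vec :=
  [set \sum_i f i |
    f in [set f : 'I_n -> vec | forall i, int_demand p i (f i)]].

Definition cost i p (x : vec) : R :=
  \sum_(j < m) payment M i j (p j) * (x j)%:~R.

Lemma tot_intv (x : bundle m) X : tot (intv x) X = (Defs.total x X)%:Z.
Proof.
by rewrite /tot /Defs.total PoszS; apply: eq_bigr => j _; rewrite ffunE.
Qed.

Lemma utilityE i x p : utility M i x p = valuation M i x - cost i p (intv x).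
Proof.
by congr (_ - _); apply: eq_bigr => j _; rewrite ffunE.
Qed.

Lemma cost_exchange i p (x : vec) j k :
  cost i p (x - unitv (Some j) + unitv k) = cost i p x - payment M i j (p j)
    + (if k is Some l then payment M i l (p l) else 0).
Proof.
have cost1 l :
    \sum_(t < m) payment M i t (p t) * (l == t : nat)%:~R = payment M i l (p l).
  rewrite (bigD1 l) //= eqxx mulr1 big1 ?addr0 // => t tl.
  by rewrite eq_sym (negbTE tl) mulr0.
rewrite /cost; under eq_bigr do rewrite exchangeE intrD intrB mulrDr mulrBr.
rewrite big_split sumrB /= cost1; congr (_ + _).
by case: k => [l|]; [exact: cost1|rewrite big1 // => t _; rewrite mulr0].
Qed.

Lemma payment_le i j (t u : R) : 0 <= t -> t <= u ->
  payment M i j t <= payment M i j u.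
Proof.
move=> t0; rewrite le_eqVlt => /orP[/eqP -> //|tu].
exact/ltW/payment_increasing.
Qed.

Lemma demand_exchange i p q (x y : vec) j :
  (forall l, 0 <= p l) -> (forall l, p l <= q l) ->
  int_demand p i x -> int_demand q i y -> p j = q j -> y j < x j ->
  exists k, [/\ below x y k, if k is Some l then p l = q l else True,
    int_demand p i (x - unitv (Some j) + unitv k) &
    int_demand q i (y + unitv (Some j) - unitv k)].
Proof.
move=> p0 pq [bx [bxs ux] <-] [b_y [bys uy] <-] pqj.
rewrite !ffunE ltz_nat => yx.
have [k [kxy vk]] := @valuation_concave _ _ _ M i _ _ bxs bys j yx.
set bx' := bundle_add _ _ in vk; set by' := bundle_sub _ _ in vk.
(* [jP] and [kP] record that no truncated subtraction is cut off at zero. *)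
have jP t : (Some j == Some t) ==> (b_y t < bx t)%N by apply/implyP => /eqP[<-].
have kP t : (k == Some t) ==> (bx t < b_y t)%N.
  by apply/implyP => /eqP kE; move: kxy; rewrite kE.
have bx's : box (supply M) bx'.
  move=> t; rewrite /bx' !ffunE; move: (bxs t) (bys t) (jP t) (kP t).
  by case: (Some j == Some t); case: (k == Some t) => /=; lia.
have by's : box (supply M) by'.
  move=> t; rewrite /by' !ffunE; move: (bxs t) (bys t) (jP t) (kP t).
  by case: (Some j == Some t); case: (k == Some t) => /=; lia.
have bx'E : intv bx' = intv bx - unitv (Some j) + unitv k.
  apply/ffunP => t; rewrite /bx' !ffunE; move: (jP t) (kP t).
  by case: (Some j == Some t); case: (k == Some t) => /=; lia.
have by'E : intv by' = intv b_y + unitv (Some j) - unitv k.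
  apply/ffunP => t; rewrite /by' !ffunE; move: (jP t) (kP t).
  by case: (Some j == Some t); case: (k == Some t) => /=; lia.
have cx' := cost_exchange i p (intv bx) j k; rewrite -bx'E in cx'.
have cy' := cost_exchange i q (intv by') j k.
rewrite {1}by'E addrAC subrK addrK -pqj in cy'.
have ux' := ux _ bx's; have uy' := uy _ by's; rewrite !utilityE in ux' uy'.
clearbody bx' by'.
set pk := (X in _ = _ + X) in cx'; set qk := (X in _ = _ + X) in cy'.
have pqk : pk <= qk by rewrite /pk /qk; case: (k) => // l; exact: payment_le.
have qpk : qk <= pk by clearbody pk qk; lra.
exists k; split.
- by case: (k) kxy => //= l; rewrite !ffunE; lia.
- rewrite /pk /qk in qpk; case: (k) qpk => // l qpl.
  apply/eqP; rewrite eq_le pq leNgt /=; apply/negP => pql.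
  by have := payment_increasing M i l (p0 l) pql; rewrite ltNge qpl.
- exists bx' => //; split=> // z zs; apply: le_trans (ux _ zs) _.
  by rewrite !utilityE; clearbody pk qk; lra.
- exists by' => //; split=> // z zs; apply: le_trans (uy _ zs) _.
  by rewrite !utilityE; clearbody pk qk; lra.
Qed.

Lemma int_demand_exchange p i : (forall j, 0 <= p j) ->
  exchange_down (int_demand p i).
Proof.
move=> p0 x y Dx Dy j yx.
have [k [kxy _ Dk _]] :=
  demand_exchange p0 (fun=> lexx _) Dx Dy (erefl (p j)) yx.
by exists k.
Qed.

Lemma int_demand_oppset_exchange p i : (forall j, 0 <= p j) ->
  exchange_down (oppset (int_demand p i)).
Proof.
move=> p0 x y Dx Dy j yx.
have yx' : (- x) j < (- y) j by rewrite !ffunE ltrN2.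
have [k [kxy _ _ Dk]] :=
  demand_exchange p0 (fun=> lexx _) Dy Dx (erefl (p j)) yx'.
exists k; first by case: (k) kxy => //= l; rewrite !ffunE ltrN2.
by rewrite /oppset /= opprD opprB addrC [_ - x]addrC addrC.
Qed.

Lemma aggregate_exchange p : (forall j, 0 <= p j) ->
  exchange_down (aggregate_demand p).
Proof.
move=> p0; apply: (@minkowski_exchange _ _ (int_demand p)) => i.
exact: int_demand_exchange.
Qed.

Lemma aggregate_oppset_exchange p : (forall j, 0 <= p j) ->
  exchange_down (oppset (aggregate_demand p)).
Proof.
move=> p0; rewrite oppset_minkowski.
apply: (@minkowski_exchange _ _ (fun i => oppset (int_demand p i))) => i.
exact: int_demand_oppset_exchange.
Qed.

(** * Least demand, over-demand and gross substitutes *)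

Lemma demand_nonempty p i : exists x, demand M i p x.
Proof.
have [l boxl] := finite_box (supply M).
have l0 : bundle0 \in l by apply/boxl => j; rewrite ffunE.
have [x xl xmax] := seq_argmax (fun x => utility M i x p) l0.
by exists x; split; [exact/boxl | move=> y /boxl; exact: xmax].
Qed.

(** Demand is nonempty, so [set_min] is a true minimum and not its default. *)
Lemma muP i X p : [set Defs.total x X | x in demand M i p] (mu M i X p) /\
  forall x, demand M i p x -> (mu M i X p <= Defs.total x X)%N.
Proof.
have [x Dx minx] := exists_minimizer (Defs.total^~ X) (demand_nonempty p i).
rewrite /mu /set_min.
case: xgetP => [a _ [[y Dy <-] miny]|/(_ (Defs.total x X))[]].
  by split; [exists y | move=> z Dz; apply: miny; exists z].
by split; [exists x | move=> _ [z Dz <-]; exact: minx].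
Qed.

Lemma mu_le_tot i X p (x : vec) : int_demand p i x ->
  (mu M i X p)%:Z <= tot x X.
Proof. by case=> b Db <-; rewrite tot_intv lez_nat; exact: (muP i X p).2. Qed.

Lemma mu_attained i X p : exists2 x, int_demand p i x & tot x X = mu M i X p.
Proof.
have [[x Dx xE] _] := muP i X p.
by exists (intv x); [exists x | rewrite tot_intv xE].
Qed.

Lemma overdemandE p X : overdemand M p X =
  \sum_i (mu M i X p)%:Z - tot (intv (supply M)) X.
Proof. by rewrite /overdemand tot_intv. Qed.

Lemma equilibriumP p : equilibrium M p <->
  (forall j, 0 <= p j) /\ aggregate_demand p (intv (supply M)).
Proof.
split=> -[p0].
  move=> [x [Dx xs]]; split=> //; exists (fun i => intv (x i)).
    by move=> i; exists (x i).
  apply/ffunP => j; rewrite -xs sum_ffunE !ffunE PoszS.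
  by apply: eq_bigr => i _; rewrite ffunE.
move=> [f Df fs]; split=> //.
have /choice[x xP] : forall i, exists x, demand M i p x /\ intv x = f i.
  by move=> i; have [x Dx xf] := Df i; exists x.
exists x; split=> [i|]; first exact: (xP i).1.
apply/ffunP => j; apply/eqP; rewrite -eqz_nat.
have /ffunP/(_ j) := fs; rewrite sum_ffunE !ffunE => <-.
rewrite PoszS; apply/eqP; apply: eq_bigr => i _.
by rewrite -(xP i).2 ffunE.
Qed.

(** The over-demand of the empty set is 0, so for each [X] the least demands sum to at most the
    supply of [X], as [exchange_le] requires. *)
Lemma no_overdemand p : (forall j, 0 <= p j) ->
  minimal_maximizer M p finset.set0 ->
  exists2 y, aggregate_demand p y & forall j, y j <= intv (supply M) j.
Proof.
move=> p0 min0.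
have [max0 _] : minimal_elts (fun Y Z : {set 'I_m} => Y \subset Z)
    (maximizers M p) finset.set0 by rewrite [X in X _]min0.
apply: (exchange_le (aggregate_exchange p0)).
  exact: aggregate_oppset_exchange.
move=> X.
have /choice[f fP] : forall i, exists x,
    int_demand p i x /\ tot x X = mu M i X p.
  by move=> i; have [x] := mu_attained i X p; exists x.
exists (\sum_i f i); first by exists f => // i; exact: (fP i).1.
rewrite tot_sum (eq_bigr (fun i => (mu M i X p)%:Z)); last first.
  by move=> i _; exact: (fP i).2.
have tot0 x : tot x finset.set0 = 0 by rewrite /tot big_set0.
have mu0 : \sum_i (mu M i finset.set0 p)%:Z = 0.
  by apply: big1 => i _; have [x _ <-] := mu_attained i finset.set0 p.
by have := max0 X; rewrite !overdemandE mu0 tot0 subrr subr_le0.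
Qed.

(* Gross substitutes: a rise of other prices cannot lower the demand for [T]. *)
Lemma mu_diff_le i p q (x : vec) X T : (forall j, 0 <= q j) ->
  (forall j, q j <= p j) -> (forall j, j \in X -> (j \in T) = (q j == p j)) ->
  T \subset X -> int_demand p i x ->
  (mu M i X q)%:Z - (mu M i (X :\: T) q)%:Z <= tot x T.
Proof.
move=> q0 qp TE TX Dx.
have [y0 Dy0 y0E] := mu_attained i (X :\: T) q.
(* Among minimizers on [X :\: T], [y] is closest to [x]: a surplus over [x] at a good of [T] could
   be exchanged for nothing or for a good of unchanged price, which lies outside [X :\: T]. *)
have [y [Dy yE] miny] := @exists_minimizer _
  (fun y => int_demand q i y /\ tot y (X :\: T) = mu M i (X :\: T) q) (dist^~ x)
  (ex_intro _ y0 (conj Dy0 y0E)).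
apply: (@le_trans _ _ (tot y T)).
  have := mu_le_tot X Dy; rewrite (totID y X T) yE (finset.setIidPr TX); lia.
apply: le_tot => j jT; rewrite leNgt; apply/negP => xy.
have qpj : q j = p j by apply/eqP; rewrite -TE // (fintype.subsetP TX).
have [k [kyx kqp Dk _]] := demand_exchange q0 qp Dy Dx qpj xy.
suff /miny : int_demand q i (y - unitv (Some j) + unitv k) /\
    tot (y - unitv (Some j) + unitv k) (X :\: T) = mu M i (X :\: T) q.
  by rewrite /= leqNgt dist_exchange.
split=> //; rewrite tot_exchange yE inE jT.
case: k kqp {Dk kyx} => [l kqp|_]; last by rewrite subr0 addr0.
case: (boolP (l \in X :\: T)); rewrite ?subr0 ?addr0 // inE.
by move=> /andP[/negP lT lX]; case: lT; rewrite TE // kqp.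
Qed.

(** * Prices stay below every equilibrium *)

Lemma minimal_maximizer_below_equilibrium q p X : (forall j, 0 <= q j) ->
  (forall j, q j <= p j) -> equilibrium M p -> minimal_maximizer M q X ->
  forall j, j \in X -> q j < p j.
Proof.
move=> q0 qp /equilibriumP[p0 [f Df fs]] minX j jX.
rewrite lt_neqAle qp andbT; apply/negP => qpj.
(* Dropping [T] from [X] lowers over-demand by at most the amount of [T] in the equilibrium bundles
   less its supply, which is zero. So [X :\: T] is a maximizer too, against minimality of [X]. *)
pose T := [set j in X | q j == p j]%SET.
have TX : T \subset X by apply/fintype.subsetP => l; rewrite inE => /andP[].
have [maxX minX'] : minimal_elts (fun Y Z => Y \subset Z) (maximizers M q) X.
  by rewrite [X in X _]minX.
have : ~ maximizers M q (X :\: T).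
  move=> /minX' /(_ (finset.subsetDl _ _)) XT.
  by have := jX; rewrite -{1}XT !inE jX qpj.
apply=> Y; apply: le_trans (maxX Y) _.
rewrite !overdemandE (totID _ X T) (finset.setIidPr TX) -fs (tot_sum _ T).
have : \sum_i ((mu M i X q)%:Z - (mu M i (X :\: T) q)%:Z) <= \sum_i tot (f i) T.
  apply: ler_sum => i _; apply: mu_diff_le (Df i) => // l lX.
  by rewrite inE lX.
rewrite sumrB; lra.
Qed.

(** Otherwise some good of [X] is first to reach its equilibrium price, at a step before [c]. There
    no price exceeds [q] yet, which contradicts [minimal_maximizer_below_equilibrium]. *)
Lemma move_le_equilibrium p q d X c : (forall j, 0 <= p j) ->
  (forall j, p j <= q j) -> equilibrium M q ->
  (forall j, j \in X -> 0 < d j) -> (forall j, j \notin X -> d j = 0) ->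
  (forall c', 0 <= c' < c -> minimal_maximizer M (move p c' d) X) ->
  forall j, move p c d j <= q j.
Proof.
move=> p0 pq eqq dX dNX minX.
have d0 j : 0 <= d j.
  by have [/dX/ltW //|/dNX ->] := boolP (j \in X).
suff bound j0 : j0 \in X -> move p c d j0 <= q j0.
  move=> j; have [/bound //|/dNX dj] := boolP (j \in X).
  by rewrite /move dj mulr0 addr0.
move=> j0X; rewrite leNgt; apply/negP => qj0.
(* [r j] is the step at which the price of a good [j] of [X] reaches [q j]. *)
pose r j := (q j - p j) / d j.
have [j jX minj] := @arg_minP _ _ _ j0 (mem X) r j0X.
have r0 : 0 <= r j by rewrite divr_ge0 ?subr_ge0.
have rc : r j < c.
  apply: le_lt_trans (minj _ j0X) _.
  by rewrite ltr_pdivrMr ?dX // ltrBlDl.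
have mq l : move p (r j) d l <= q l.
  have [lX|/dNX dl] := boolP (l \in X); last by rewrite /move dl mulr0 addr0.
  by rewrite /move -lerBrDl -ler_pdivlMr ?dX //; exact: minj.
have m0 l : 0 <= move p (r j) d l by rewrite addr_ge0 // mulr_ge0.
have := minimal_maximizer_below_equilibrium m0 mq eqq (minX _ _) jX.
rewrite r0 rc => /(_ isT).
by rewrite /move /r divfK ?subrKC ?ltxx ?gt_eqF ?dX.
Qed.

(** * Supply stays covered while prices rise *)

Lemma demand_tot_ge i p q (x : vec) X Z : (forall j, 0 <= p j) ->
  (forall j, p j <= q j) -> (forall j, (j \in X) = (p j < q j)) ->
  int_demand p i x ->
  exists2 y, int_demand q i y &
    (mu M i X q)%:Z - (mu M i (X :\: Z) q)%:Z + tot x (Z :\: X) <= tot y Z.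
Proof.
move=> p0 pq XE Dx.
have [y0 Dy0 y0E] := mu_attained i (X :\: Z) q.
(* Closeness to [x] forces [y] to be at least [x] on [Z :\: X]: a shortage there could be exchanged
   against nothing or a good outside [X], leaving the total on [X :\: Z] intact. *)
have [y [Dy yE] miny] := @exists_minimizer _
  (fun y => int_demand q i y /\ tot y (X :\: Z) = mu M i (X :\: Z) q) (dist x)
  (ex_intro _ y0 (conj Dy0 y0E)).
exists y => //; rewrite (totID y Z X); apply: lerD.
  by have := mu_le_tot X Dy; rewrite (totID y X Z) yE finset.setIC; lia.
apply: le_tot => j; rewrite inE => /andP[jX jZ].
rewrite leNgt; apply/negP => yx.
have pqj : p j = q j by apply/eqP; rewrite eq_le pq leNgt -XE.
have [k [kxy kpq _ Dk]] := demand_exchange p0 pq Dx Dy pqj yx.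
have yE' : y + unitv (Some j) - unitv k - unitv (Some j) + unitv k = y.
  by rewrite [_ - unitv k]addrAC addrK subrK.
suff /miny : int_demand q i (y + unitv (Some j) - unitv k) /\
    tot (y + unitv (Some j) - unitv k) (X :\: Z) = mu M i (X :\: Z) q.
  by rewrite /= leqNgt dist_exchange_r.
split=> //; rewrite -{}yE -[in RHS]yE' [RHS]tot_exchange inE (negbTE jX) andbF.
case: k kpq {Dk kxy yE'} => [l kpq|_]; last by rewrite [RHS]addr0 [RHS]subr0.
by rewrite inE XE kpq ltxx andbF [RHS]addr0 [RHS]subr0.
Qed.

(** As [X] maximizes over-demand at [q], dropping [Z] from [X] lowers the summed least demands by at
    least the supply of [X :&: Z]; goods of [Z :\: X] keep their former coverage. Hence
    [exchange_ge] applies. *)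
Lemma no_underdemand_move p q X : (forall j, 0 <= p j) ->
  (forall j, p j <= q j) -> (forall j, (j \in X) = (p j < q j)) ->
  minimal_maximizer M q X ->
  (exists2 x, aggregate_demand p x & forall j, intv (supply M) j <= x j) ->
  exists2 x, aggregate_demand q x & forall j, intv (supply M) j <= x j.
Proof.
move=> p0 pq XE minX [_ [f Df <-] sf].
have q0 j : 0 <= q j by exact: le_trans (pq j).
have [maxX _] : minimal_elts (fun Y Z => Y \subset Z) (maximizers M q) X.
  by rewrite [X in X _]minX.
apply: (exchange_ge (aggregate_exchange q0)).
  exact: aggregate_oppset_exchange.
move=> Z.
have /choice[g gP] : forall i, exists y, int_demand q i y /\
    (mu M i X q)%:Z - (mu M i (X :\: Z) q)%:Z + tot (f i) (Z :\: X) <= tot y Z.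
  by move=> i; have [y] := demand_tot_ge Z p0 pq XE (Df i); exists y.
exists (\sum_i g i); first by exists g => // i; exact: (gP i).1.
rewrite tot_sum; apply: le_trans (ler_sum _ (fun i _ => (gP i).2)).
rewrite big_split sumrB /= -tot_sum (totID _ Z X); apply: lerD; last first.
  exact: le_tot.
have := maxX (X :\: Z); rewrite !overdemandE (totID _ X Z) finset.setIC; lra.
Qed.

(** * Passage to the price at the event *)

Lemma payment_move_cvg i j p d c : 0 <= p j -> 0 <= d j -> 0 < c ->
  payment M i j (move p c' d j) @[c' --> c^'-] --> payment M i j (move p c d j).
Proof.
move=> p0 d0 c0.
have m0 c' : 0 < c' -> 0 <= move p c' d j.
  by move=> c'0; rewrite addr_ge0 // mulr_ge0 // ltW.
have /subspace_continuousP/(_ _ (m0 _ c0)) cont :=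
  @payment_continuous _ _ _ M i j.
(* Continuity is given within nonnegative prices, where the path stays for [c' > 0]. *)
apply: cvg_comp cont => U; rewrite nbhs_simpl /within /= => nU.
have mc : move p c' d j @[c' --> c^'-] --> move p c d j.
  apply: cvg_at_left_filter; apply: cvgD; first exact: cvg_cst.
  by apply: cvgMr_tmp; exact: cvg_id.
have nU' : \forall c' \near c^'-, 0 <= move p c' d j -> U (move p c' d j).
  exact: (mc _ nU).
change (\forall c' \near c^'-, U (move p c' d j)).
by apply: filterS2 nU' (nbhs_left_gt c0) => c' Uc' c'0; apply/Uc'/m0.
Qed.

Lemma utility_move_cvg i (x : bundle m) p d c : (forall j, 0 <= p j) ->
  (forall j, 0 <= d j) -> 0 < c ->
  utility M i x (move p c' d) @[c' --> c^'-] --> utility M i x (move p c d).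
Proof.
move=> p0 d0 c0; apply: cvgB; first exact: cvg_cst.
apply: cvg_big => [|j _]; first exact: add_continuous.
apply: cvgMr_tmp.
exact: payment_move_cvg.
Qed.

(** A bundle not demanded at the limit is strictly beaten there, hence also just before it; the box
    has finitely many bundles. *)
Lemma demand_upper_hemicontinuous i p d c : (forall j, 0 <= p j) ->
  (forall j, 0 <= d j) -> 0 < c ->
  \forall c' \near c^'-, demand M i (move p c' d) `<=` demand M i (move p c d).
Proof.
move=> p0 d0 c0; have [l boxl] := finite_box (supply M).
have : \forall c' \near c^'-, forall x, x \in l ->
    demand M i (move p c' d) x -> demand M i (move p c d) x.
  apply: near_all => x /boxl xs.
  have [Dx|nDx] := pselect (demand M i (move p c d) x).
    by apply: filterE.
  have [y ys xy] : exists2 y, box (supply M) y &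
      utility M i x (move p c d) < utility M i y (move p c d).
    apply: contrapT => ny; apply: nDx; split=> // y ys.
    by rewrite leNgt; apply/negP => xy; apply: ny; exists y.
  have cv : utility M i y (move p c' d) - utility M i x (move p c' d)
      @[c' --> c^'-] -->
      utility M i y (move p c d) - utility M i x (move p c d).
    by apply: cvgB; exact: utility_move_cvg.
  have xy0 : 0 < utility M i y (move p c d) - utility M i x (move p c d).
    by rewrite subr_gt0.
  apply: (filterS _ (cvgr_gt _ cv _ xy0)) => c' /=.
  rewrite subr_gt0 => xy' [_ /(_ _ ys)].
  by rewrite leNgt xy'.
apply: filterS => c' Dl x [xs ux]; apply: Dl => //; exact/boxl.
Qed.

(** At the event [X] may cease to be the minimal maximizer, so [no_underdemand_move] is applied just
    before it, at a price whose demanded bundles remain demanded at the event. *)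
Lemma no_underdemand_step p d X c : (forall j, 0 <= p j) ->
  (forall j, j \in X -> 0 < d j) -> (forall j, j \notin X -> d j = 0) ->
  0 < c -> (forall c', 0 < c' < c -> minimal_maximizer M (move p c' d) X) ->
  (exists2 x, aggregate_demand p x & forall j, intv (supply M) j <= x j) ->
  exists2 x, aggregate_demand (move p c d) x &
    forall j, intv (supply M) j <= x j.
Proof.
move=> p0 dX dNX c0 minX under.
have d0 j : 0 <= d j by have [/dX/ltW //|/dNX ->] := boolP (j \in X).
have near_dem : \forall c' \near c^'-, forall i,
    demand M i (move p c' d) `<=` demand M i (move p c d).
  by apply: filter_forall => i; exact: demand_upper_hemicontinuous.
have [c' [[c'0 c'c] sub]] := filter_ex
  (filterI (filterI (nbhs_left_gt c0) (nbhs_left_lt c)) near_dem).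
have le_move j : p j <= move p c' d j by rewrite lerDl mulr_ge0 // ltW.
have XE j : (j \in X) = (p j < move p c' d j).
  rewrite ltrDl; have [jX|jX] := boolP (j \in X); first by rewrite mulr_gt0 ?dX.
  by rewrite dNX // mulr0 ltxx.
have [|_ [f Df <-] sf] := no_underdemand_move p0 le_move XE _ under.
  by apply: minX; rewrite c'0.
exists (\sum_i f i) => //; exists f => // i.
by have [x Dx <-] := Df i; exists x => //; exact: sub.
Qed.

(** * Invariants of the auction *)

Lemma no_underdemand0 : (0 < n)%N ->
  exists2 x, aggregate_demand (fun=> 0) x &
    forall j, intv (supply M) j <= x j.
Proof.
(* At price zero monotonicity makes every buyer demand the whole supply. *)
move=> n0; exists (\sum_(i < n) intv (supply M)).
  exists (fun=> intv (supply M)) => // i; exists (supply M) => //.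
  split=> [j //|y ys].
  rewrite /utility !big1 ?subr0 => [|j _|j _]; rewrite ?payment0 ?mul0r //.
  exact: valuation_monotone.
move=> j; rewrite sum_ffunE (bigD1 (Ordinal n0)) //= lerDl.
by apply: sumr_ge0 => i _; rewrite ffunE.
Qed.

Lemma auction_reaches_invariant p : (0 < n)%N -> auction_reaches M p ->
  [/\ forall j, 0 <= p j,
    exists2 x, aggregate_demand p x & forall j, intv (supply M) j <= x j &
    forall q, equilibrium M q -> forall j, p j <= q j].
Proof.
move=> n0; elim=> {p} [|p X d c _ [p0 under below] [minX [t [_ dE]]] _
    [c0 _ noevent]].
  by split=> //; [exact: no_underdemand0 | move=> q [q0 _]].
have dX j : j \in X -> 0 < d j by rewrite dE => ->; exact: expR_gt0.
have dNX j : j \notin X -> d j = 0 by rewrite dE => /negbTE ->.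
have d0 j : 0 <= d j by have [/dX/ltW //|/dNX ->] := boolP (j \in X).
(* Loss of minimal maximality before [c] would be an earlier event. *)
have minXc c' : 0 < c' < c -> minimal_maximizer M (move p c' d) X.
  by move=> /noevent ne; apply: contrapT => nmin; apply: ne; left.
split=> [j||q eqq].
- by rewrite addr_ge0 // mulr_ge0 // ltW.
- exact: no_underdemand_step dX dNX c0 minXc under.
- apply: (move_le_equilibrium p0 (below q eqq) eqq dX dNX) => c' /andP[].
  (* At [c' = 0] the claim comes from the direction procedure. *)
  rewrite le_eqVlt => /orP[/eqP <- _|c'0 c'c].
    suff -> : move p 0 d = p by [].
    by apply/funext => j; rewrite /move mul0r addr0.
  by apply: minXc; rewrite c'0.
Qed.

End Market.

Theorem theorem3p2 (R : realType) (m n : nat) (n_ge2 : (2 <= n)%N)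
    (M : market R m n) (pstar : 'I_m -> R) (Hout : auction_output M pstar) :
  equilibrium M pstar /\
  forall p : 'I_m -> R, equilibrium M p -> forall j : 'I_m, pstar j <= p j.
Proof.
have [reach [d [min0 _]]] := Hout.
have [p0 [x Dx sx] le_eq] := auction_reaches_invariant (ltnW n_ge2) reach.
(* Termination yields a selection within the supply; the invariant yielded one covering it. *)
have [y Dy ys] := no_overdemand p0 min0.
split=> //; apply/equilibriumP; split=> //.
exact: exchange_between (aggregate_exchange p0) Dx Dy ys sx.
Qed.
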